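(* Let $m \geq 2$ and let $n_1, \ldots, n_m \geq 1$ be integers. Let $G = K_{n_1, n_2, \ldots, n_m}$ be the complete multipartite graph with $m$ parts of sizes $n_i$, $1 \leq i \leq m$, and let $N = \sum_{i=1}^m n_i$. Then $d(G) = N-1$ if either $n_1 = n_2 = \cdots = n_m = 1$, or both $m = 2$ and $1 \in \{n_1, n_2\}$; and $d(G) = N-2$ otherwise.
   Context: Graphs are finite and simple. The deduction game on a graph $G$: a layout is a placement of searchers on vertices of $G$ (a vertex may receive several searchers). A vertex is occupied in the layout if it contains at least one searcher, and unoccupied otherwise. A vertex is protected if it is occupied in the initial layout or if a searcher has moved there at some point, and unprotected otherwise. A vertex is fireable if the number of searchers on it is greater than or equal to the number of its unprotected neighbours. Initially every searcher is mobile; once a searcher has moved once, it becomes immobile (cannot move again). At each stage, simultaneously, for every fireable vertex $v$ containing mobile searchers, one searcher moves from $v$ to each unprotected neighbour of $v$ (excess searchers stay on $v$; several fireable vertices may send a searcher to the same target). Stages continue until no new searchers move. The layout is successful if at the end all vertices of $G$ are protected. The deduction number $d(G)$ is the minimum number of searchers in a successful layout on $G$. *)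

(* Defs.v *)
From mathcomp Require Import all_boot.

Set Implicit Arguments.
Unset Strict Implicit.
Unset Printing Implicit Defensive.

Record sgraph := SGraph {
  vertex :> finType;
  adj : rel vertex;
  adj_sym : symmetric adj;
  adj_irrefl : irreflexive adj }.

Arguments adj {G} : rename.

Section DeductionGame.
Variable G : sgraph.
Implicit Types (v w : G) (k : nat).

(* A layout is identified with the number of searchers on each vertex. *)
Definition layout := {ffun G -> nat}.

Definition searchers (L : layout) : nat := \sum_v L v.

Record state := State {
  mobile : {ffun G -> nat};
  immobile : {ffun G -> nat};
  protected : {set G} }.

Implicit Types (s : state) (L : layout).

Definition init L : state :=
  State L [ffun=> 0] [set v | 0 < L v].

Definition unprot_nbrs s v : {set G} :=
  [set w | adj v w & w \notin protected s].

Definition fireable s v : bool :=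
  #|unprot_nbrs s v| <= mobile s v + immobile s v.

Definition fires s v : bool := fireable s v && (0 < mobile s v).

(* One stage.  The subtraction never truncates in a play: searchers only enter
   vertices that were unoccupied at the start, so no vertex ever carries both
   mobile and immobile searchers. *)
Definition stage s : state :=
  State
    [ffun v => if fires s v then mobile s v - #|unprot_nbrs s v|
               else mobile s v]
    [ffun w => immobile s w
               + #|[set v | fires s v & w \in unprot_nbrs s v]|]
    (protected s :|: \bigcup_(v | fires s v) unprot_nbrs s v).

Definition halted s : bool :=
  [forall v, fires s v ==> (unprot_nbrs s v == set0)].

(* #|G| stages suffice to reach the end of the play: see [final_halted] and
   [halted_stage]. *)
Definition final L : state := iter #|G| stage (init L).

Definition successful L : bool := protected (final L) == [set: G].

Lemma halted_stage s : halted s -> stage s = s.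
Proof.
move=> /forallP hs.
have nbr0 v : fires s v -> unprot_nbrs s v = set0.
  by move=> fv; apply/eqP; move: (hs v); rewrite fv.
case: s hs nbr0 => a b p hs nbr0; congr State => /=.
- apply/ffunP=> v; rewrite ffunE; case: ifP => // /nbr0 ->.
  by rewrite cards0 subn0.
- apply/ffunP=> w; rewrite ffunE /= (_ : [set v | _ & _] = set0) ?cards0 ?addn0//.
  apply/setP=> v; rewrite [LHS]inE [RHS]inE; apply/negP => /andP[fv].
  by rewrite nbr0 // inE.
- by rewrite big1 ?setU0.
Qed.

Lemma final_halted L : halted (final L).
Proof.
have prog k : halted (iter k stage (init L)) \/
    k <= #|protected (iter k stage (init L))|.
  elim: k => [|k [IH|IH]]; first by right.
    by left; rewrite iterS halted_stage.
  set s := iter k stage (init L) in IH *.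
  case: (boolP (halted s)) => [hs|]; first by left; rewrite iterS halted_stage.
  rewrite negb_forall => /existsP[v]; rewrite negb_imply => /andP[fv].
  case/set0Pn=> w hw; right; rewrite iterS; apply: leq_ltn_trans IH _.
  apply: proper_card; apply/properP; split; first exact: subsetUl.
  exists w; last by move: hw; rewrite inE => /andP[].
  by rewrite inE; apply/orP; right; apply/bigcupP; exists v.
case: (prog #|G|) => // full; apply/forallP => v; apply/implyP => _.
have /eqP E : protected (final L) == [set: G].
  by rewrite eqEcard subsetT cardsT.
by apply/eqP/setP => w; rewrite !inE E inE andbF.
Qed.

(* Bounding each entry by k loses no layout with k searchers in total, and makes
   the search space finite. *)
Definition winnable k : bool :=
  [exists L : {ffun G -> 'I_k.+1},
     (searchers [ffun v => val (L v)] == k) && successful [ffun v => val (L v)]].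

Lemma winnableP k :
  reflect (exists2 L, searchers L = k & successful L) (winnable k).
Proof.
apply: (iffP existsP) => [[L /andP[/eqP sL wL]]|[L sL wL]].
  by exists [ffun v => val (L v)].
have Lk v : L v < k.+1 by rewrite ltnS -sL /searchers (bigD1 v) //= leq_addr.
exists [ffun v => Ordinal (Lk v)].
rewrite (_ : [ffun v => _] = L) ?sL ?eqxx ?wL //.
by apply/ffunP=> v; rewrite !ffunE.
Qed.

Lemma ex_winnable : exists k, winnable k.
Proof.
exists (searchers [ffun=> 1]); apply/winnableP; exists [ffun=> 1] => //.
have mono k : protected (iter k stage (init [ffun=> 1])) = [set: G].
  elim: k => [|k IH]; first by apply/setP => v; rewrite !inE ffunE.
  by rewrite iterS /= IH setTU.
by rewrite /successful /final mono.
Qed.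

Definition deduction_number : nat := ex_minn ex_winnable.

Lemma deduction_number_attained :
  exists2 L, searchers L = deduction_number & successful L.
Proof. by rewrite /deduction_number; case: ex_minnP => k /winnableP. Qed.

Lemma deduction_number_le L : successful L -> deduction_number <= searchers L.
Proof.
rewrite /deduction_number; case: ex_minnP => k _ kmin wL.
by apply: kmin; apply/winnableP; exists L.
Qed.

End DeductionGame.

Section CompleteMultipartite.
Variables (m : nat) (n : 'I_m -> nat).

(* The pair (i, j) is the j-th vertex of the i-th part. *)
Definition multipartite_vertex : finType := {i : 'I_m & 'I_(n i)}.

Definition multipartite_adj : rel multipartite_vertex :=
  fun u v => tag u != tag v.

Lemma multipartite_adj_sym : symmetric multipartite_adj.
Proof. by move=> u v; rewrite /multipartite_adj eq_sym. Qed.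

Lemma multipartite_adj_irrefl : irreflexive multipartite_adj.
Proof. by move=> u; rewrite /multipartite_adj eqxx. Qed.

Definition complete_multipartite : sgraph :=
  SGraph multipartite_adj_sym multipartite_adj_irrefl.

End CompleteMultipartite.

(* Main.v *)
Require Import Defs.
From mathcomp Require Import all_boot.
From mathcomp Require Import zify.

(** The theorem rests on a static description of the successful layouts
    ([successfulP]).  Call a set [T] of unoccupied vertices stuck when every
    occupied vertex with a neighbour in [T] has fewer searchers than it has
    neighbours in [T].  No vertex of a stuck set is ever protected, since the
    first vertex to send a searcher into [T] would have to serve all of its
    neighbours in [T] with its initial searchers; and at the end of a play the
    unprotected vertices form a stuck set.  So a layout is successful exactly
    when no nonempty stuck set exists.

    In a complete multipartite graph let [U] be the set of unoccupied vertices
    of a successful layout, assumed nonempty.  As [U] is not stuck, some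
    occupied [v], in a part [A], has a neighbour in [U] and at least
    [#|U :\: A|] searchers.  If [U] misses [A], then [v] alone accounts for all
    of [U], and at least [N - 1] searchers are in play.  Otherwise [U :&: A] is not stuck either, so some
    occupied [x] outside [A] has at least [#|U :&: A|] searchers; [v] and [x]
    together account for [U], whence [N - 2] searchers.  In that second case
    [A] contains [v] and a vertex of [U], and the complement of [A] contains [x]
    and a vertex of [U]: a saving of two searchers requires a part having at
    least two vertices inside it and at least two outside
    ([searchers_lower_bound]).

    Conversely, given two vertices [a], [a'] of such a part and two vertices
    [b], [x] outside it, one searcher on each vertex except [a] and [b] wins:
    [a'] protects [b] and [x] protects [a] ([successful_all_but_two]).  Leaving a
    single vertex unoccupied always wins, since any neighbour protects it
    ([successful_all_but_one]).  The exceptional graphs are precisely those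
    without a part of the kind above ([split_partP]). *)

Set Implicit Arguments.
Unset Strict Implicit.
Unset Printing Implicit Defensive.

(** * Stuck sets in an arbitrary graph *)

Section Criterion.
Variable G : sgraph.
Implicit Types (v w : G) (D T : {set G}) (L : layout G) (s : state G).

Definition unoccupied L : {set G} := [set v | L v == 0].

Definition nbrs_in T v : {set G} := [set w in T | adj v w].

(** The part of the play that matters for one vertex: a vertex that still has
    mobile searchers has received none, so that it can never serve more targets
    than its initial searchers allow; and a vertex that no longer has all its
    initial searchers has already had all its neighbours protected. *)
Definition play_invariant L s : Prop :=
  [/\ forall v, mobile s v <= L v,
      forall v, 0 < L v -> immobile s v = 0,
      forall v, mobile s v = L v \/ unprot_nbrs s v = set0
    & forall v, 0 < L v -> v \in protected s].

Lemma play_invariant_iter L k : play_invariant L (iter k (@stage G) (init L)).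
Proof.
elim: k => [|k]; first by split=> v /=; rewrite ?ffunE ?inE //; left.
rewrite iterS; set s := iter k _ _ => -[mobL imm0 spent occ].
split=> v /=.
- rewrite ffunE; case: ifP => _; last exact: mobL.
  exact: leq_trans (leq_subr _ _) (mobL v).
- move=> Lv; rewrite ffunE imm0 // add0n; apply/eqP; rewrite cards_eq0.
  by apply/eqP/setP => u; rewrite !inE occ // !andbF.
- rewrite ffunE; case: ifP => fv; [right | case: (spent v) => [|nbr0]].
  + apply/setP => w; rewrite !inE negb_or; apply/negP => /and3P[vw wP].
    by case/negP; apply/bigcupP; exists v; rewrite // inE vw.
  + by left.
  + right; apply/setP => w; move/setP/(_ w): nbr0; rewrite !inE negb_or.
    by rewrite andbA => ->.
- by move=> Lv; rewrite inE occ.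
Qed.

Definition stuck L T : Prop :=
  forall v, 0 < L v -> nbrs_in T v != set0 -> L v < #|nbrs_in T v|.

(** By induction on the stages: while [T] is unprotected, a vertex firing into
    [T] needs one searcher for each of its neighbours in [T], and the searchers
    of a vertex able to fire are among its initial ones. *)
Lemma stuck_unprotected L T k : T \subset unoccupied L -> stuck L T ->
  [disjoint T & protected (iter k (@stage G) (init L))].
Proof.
move=> TU stuckT; elim: k => [|k].
  rewrite disjoint_subset; apply/subsetP => w /(subsetP TU).
  by rewrite !inE => /eqP ->.
rewrite iterS /=; have [] := play_invariant_iter L k.
set s := iter k _ _ => mobL imm0 _ _ disT.
rewrite disjoint_subset; apply/subsetP => w wT.
rewrite !inE (disjointFr disT wT) /=.
apply/negP => /bigcupP[v /andP[fv mv] vw].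
have Lv : 0 < L v := leq_trans mv (mobL v).
have sub : nbrs_in T v \subset unprot_nbrs s v.
  apply/subsetP => u; rewrite !inE => /andP[uT ->] /=.
  by rewrite (disjointFr disT uT).
have: nbrs_in T v != set0.
  by apply/set0Pn; exists w; move: vw; rewrite !inE wT => /andP[].
move/(stuckT v Lv); rewrite ltnNge => /negP[].
apply: leq_trans (subset_leq_card sub) _; apply: leq_trans fv _.
by rewrite imm0 // addn0.
Qed.

(** An occupied vertex with enough searchers for its unprotected neighbours
    would still fire if it had not yet done so, against the end of the play; and
    if it had fired, it would have no unprotected neighbour left. *)
Lemma stuck_final L : stuck L (~: protected (final L)).
Proof.
have := final_halted L; have := play_invariant_iter L #|G|.
rewrite -/(final L); case=> _ imm0 spent _ /forallP halt v Lv.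
have -> : nbrs_in (~: protected (final L)) v = unprot_nbrs (final L) v.
  by apply/setP => w; rewrite !inE andbC.
case: (spent v) => [mv|->]; last by rewrite eqxx.
apply: contraNltn => le; move/implyP: (halt v); apply.
by rewrite /fires /fireable imm0 // addn0 mv le.
Qed.

Theorem successfulP L :
  successful L <->
  forall T, T \subset unoccupied L -> T != set0 ->
    exists v, [/\ 0 < L v, nbrs_in T v != set0 & #|nbrs_in T v| <= L v].
Proof.
split=> [/eqP win T TU T0|all_free].
  case: (pickP [pred v | [&& 0 < L v, nbrs_in T v != set0
                          & #|nbrs_in T v| <= L v]]) => [v /and3P[]|none].
    by exists v.
  have stuckT : stuck L T.
    by move=> v Lv nv; move: (none v); rewrite /= Lv nv ltnNge /= => ->.
  have := stuck_unprotected #|G| TU stuckT; rewrite -/(final L) win => dis.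
  by case/set0Pn: T0 => w wT; have := disjointFr dis wT; rewrite inE.
apply/eqP; case: (eqVneq (~: protected (final L)) set0) => [|T0].
  by move/(congr1 (@setC _)); rewrite setCK setC0.
have TU : ~: protected (final L) \subset unoccupied L.
  have [_ _ _ occ] := play_invariant_iter L #|G|.
  apply/subsetP => w; rewrite !inE; apply: contraNT; rewrite -lt0n.
  exact: occ.
have [v [Lv nv]] := all_free _ TU T0.
by rewrite leqNgt stuck_final.
Qed.

(** Every vertex outside [D] and outside the unoccupied set holds a searcher. *)
Lemma searchers_ge L D :
  \sum_(v in D) L v + #|G| <= searchers L + #|unoccupied L| + #|D|.
Proof.
rewrite /searchers [\sum_v L v](bigID (fun v => v \in D)) /=.
have: #|~: (D :|: unoccupied L)| <= \sum_(v | v \notin D) L v.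
  rewrite -sum1_card [leqRHS](bigID (fun v => v \notin unoccupied L)) /=.
  apply: leq_trans (leq_addr _ _).
  rewrite (eq_bigl (fun v => (v \notin D) && (v \notin unoccupied L))).
    by apply: leq_sum => v /andP[_]; rewrite !inE lt0n.
  by move=> v; rewrite !inE negb_or.
rewrite -[#|G|](cardsC (D :|: unoccupied L)).
have := cardsUI D (unoccupied L).
lia.
Qed.

Definition all_but D : layout G := [ffun v => (v \notin D : nat)].

Lemma unoccupied_all_but D : unoccupied (all_but D) = D.
Proof. by apply/setP => v; rewrite inE ffunE eqb0 negbK. Qed.

Lemma searchers_all_but D : searchers (all_but D) + #|D| = #|G|.
Proof.
rewrite -(cardsC D) addnC; congr (_ + _).
rewrite -sum1_card big_mkcond /=; apply: eq_bigr => v _.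
by rewrite ffunE inE; case: (v \notin D).
Qed.

Lemma successful_all_but_one u v : adj v u -> successful (all_but [set u]).
Proof.
move=> vu; apply/successfulP => T; rewrite unoccupied_all_but => TU T0.
have -> : T = [set u].
  by apply/eqP; move: TU; rewrite subset1 (negPf T0) orbF.
have uv : v != u by apply: contraTneq vu => ->; rewrite adj_irrefl.
exists v; have -> : nbrs_in [set u] v = [set u].
  by apply/setP => w; rewrite !inE; case: eqP => //= ->.
by rewrite ffunE inE uv cards1; split=> //; apply/set0Pn; exists u; rewrite inE.
Qed.

(** [a'] sees only [b], while [x] need only see [a]: if it also sees [b], it
    moves once [a'] has protected [b]. *)
Lemma successful_all_but_two a b a' x :
    adj a' b -> ~~ adj a' a -> a' != a -> adj x a -> x != b ->
  successful (all_but [set a; b]).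
Proof.
move=> a'b a'a a'Na xa xNb.
have xNa : x != a by apply: contraTneq xa => ->; rewrite adj_irrefl.
have a'Nb : a' != b by apply: contraTneq a'b => ->; rewrite adj_irrefl.
apply/successfulP => T; rewrite unoccupied_all_but => /subsetP TU T0.
have [bT|bNT] := boolP (b \in T).
  exists a'; have -> : nbrs_in T a' = [set b].
    apply/setP => w; rewrite !inE; apply/andP/eqP => [[wT aw]|->] //.
    by move/TU: wT; rewrite !inE => /pred2P[wa|//]; rewrite -wa aw in a'a.
  rewrite ffunE !inE negb_or a'Na a'Nb cards1; split=> //.
  by apply/set0Pn; exists b; rewrite inE.
have aT w : w \in T -> w = a.
  move=> wT; move/TU: (wT); rewrite !inE => /pred2P[//|wb].
  by rewrite -wb wT in bNT.
exists x; have -> : nbrs_in T x = [set a].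
  apply/setP => w; rewrite !inE; apply/andP/eqP => [[/aT]|->] //.
  by case/set0Pn: T0 => u uT; have ua := aT u uT; rewrite ua in uT.
rewrite ffunE !inE negb_or xNa xNb cards1; split=> //.
by apply/set0Pn; exists a; rewrite inE.
Qed.

End Criterion.

(** * Complete multipartite graphs *)

Section Multipartite.
Variables (m : nat) (n : 'I_m -> nat).
Local Notation V := (complete_multipartite n).
Implicit Types (u v w : V) (L : layout V).

Definition part (k : 'I_m) : {set V} := [set u : V | tag u == k].

Lemma card_complete_multipartite : #|V| = \sum_(i < m) n i.
Proof.
rewrite card_tagged sumnE big_map big_enum /=.
by apply: eq_bigr => i _; rewrite card_ord.
Qed.

Lemma card_part k : #|part k| = n k.
Proof.
rewrite -[RHS]card_ord -cardsT.
have inj : injective (fun j : 'I_(n k) => Tagged (fun i => 'I_(n i)) j : V).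
  move=> x y /(congr1 (tagged_as (Tagged (fun i => 'I_(n i)) x))).
  by rewrite !tagged_asE.
rewrite -(card_imset _ inj); apply: eq_card => -[i j]; rewrite inE /=.
apply/eqP/imsetP => [ik|[j' _ /(congr1 (@tag _ _))] //].
by subst i; exists j.
Qed.

Definition split_part k := (1 < #|part k|) && (1 < #|~: part k|).

Lemma nbrs_in_part T v : nbrs_in T v = T :\: part (tag v).
Proof.
by apply/setP => w; rewrite !inE /adj /= /multipartite_adj eq_sym andbC.
Qed.

Lemma searchers_lower_bound L : successful L ->
  #|V| <= (searchers L).+1 \/
  #|V| <= (searchers L).+2 /\ exists k, split_part k.
Proof.
move=> win; set U := unoccupied L.
have [U0|U0] := eqVneq U set0.
  by left; have := searchers_ge L set0; rewrite -/U U0 !cards0 big_set0; lia.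
move/successfulP: win => free.
have [v [Lv]] := free U (subxx _) U0.
rewrite nbrs_in_part; set A := part _ => UD0 vU.
have vA : v \in A by rewrite inE.
have [UA0|UA0] := eqVneq (U :&: A) set0.
  left; have := searchers_ge L [set v]; rewrite big_set1 cards1.
  by have := cardsID A U; rewrite UA0 cards0 -/U; lia.
have [x [Lx]] := free (U :&: A) (subsetIl _ _) UA0.
rewrite nbrs_in_part => xnb xU.
have xA : x \notin A.
  apply: contraNN xnb; rewrite inE => /eqP ->.
  by apply/eqP/setP => w; rewrite !inE; case: eqP; rewrite ?andbF.
have UAx : (U :&: A) :\: part (tag x) = U :&: A.
  apply/setP => w; rewrite !inE; case: eqP => //= ->.
  by move: xA; rewrite inE => /negPf ->; rewrite andbF.
rewrite {}UAx in xnb xU.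
have vx : v != x by apply: contraNneq xA => <-.
right; split.
  have : L v + L x + #|V| <= searchers L + #|U| + 2.
    have := searchers_ge L [set v; x].
    by rewrite big_setU1 ?inE // big_set1 cards2 vx.
  by have := cardsID A U; lia.
have occ w y : w \in U -> 0 < L y -> w != y.
  by rewrite inE => /eqP Lw; apply: contraTneq => <-; rewrite Lw.
exists (tag v); apply/andP; split; apply/card_gt1P.
  case/set0Pn: UA0 => w /setIP[wU wA]; exists w, v; split=> //; exact: occ.
case/set0Pn: UD0 => w /setDP[wU wA]; exists w, x.
by split; [move: wA|move: xA|exact: occ]; rewrite !inE.
Qed.

Lemma deduction_number_split k :
  split_part k -> deduction_number V <= #|V| - 2.
Proof.
case/andP=> /card_gt1P[a [a' [ak a'k aa']]] /card_gt1P[b [x [bk xk bx]]].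
move: ak a'k bk xk; rewrite !inE => /eqP ak /eqP a'k bk xk.
have ab : a != b by apply: contraNneq bk => <-; apply/eqP.
have := searchers_all_but [set a; b]; rewrite cards2 ab => <-; rewrite addnK.
apply/deduction_number_le/(@successful_all_but_two _ a b a' x);
  rewrite /adj /= /multipartite_adj ?ak ?a'k ?eqxx // 1?eq_sym //.
Qed.

Lemma deduction_number_adj u v : adj u v -> deduction_number V <= #|V| - 1.
Proof.
move=> /successful_all_but_one/deduction_number_le.
by have := searchers_all_but [set v]; rewrite cards1 => <-; rewrite addnK.
Qed.

(** A part with two vertices or more fails to split the graph only when its
    complement is a single vertex, which forces two parts, one of size 1. *)
Lemma split_partP : 2 <= m -> (forall i, 1 <= n i) ->
  (exists k, split_part k) <->
  ~ ((forall i, n i = 1) \/ (m = 2 /\ exists i, n i = 1)).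
Proof.
move=> m_ge2 n_gt0; split=> [[k /andP[]]|not_exc].
  rewrite card_part => nk compl [n1|[m2 [i ni]]]; first by rewrite n1 in nk.
  suff: #|~: part k| <= #|part i| by rewrite card_part ni leqNgt compl.
  apply/subset_leq_card/subsetP => u; rewrite !inE -!val_eqE /=.
  have: val k != val i by apply: contraTneq nk => /val_inj ->; rewrite ni.
  by have := ltn_ord k; have := ltn_ord i; have := ltn_ord (tag u) => /=; lia.
have [k nk] : exists k, 1 < n k.
  apply/existsP; apply: contraPT not_exc => /existsPn n_le1 not_exc.
  by case: not_exc; left=> i; have := n_gt0 i; have := n_le1 i; lia.
have : 0 < #|[set~ k]| by rewrite cardsC1 card_ord; lia.
case/card_gt0P => i; rewrite !inE => ik.
exists k; rewrite /split_part card_part nk /=.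
have vtx j : exists v : V, tag v = j.
  by exists (Tagged (fun i => 'I_(n i)) (Ordinal (n_gt0 j))).
have [m2|m_neq2] := eqVneq m 2.
  have ni : 1 < n i.
    rewrite ltn_neqAle n_gt0 andbT eq_sym; apply/eqP => ni.
    by apply: not_exc; right; split=> //; exists i.
  rewrite -(card_part i) in ni; apply: leq_trans ni _.
  by apply/subset_leq_card/subsetP => u; rewrite !inE => /eqP ->.
have /card_gt1P[j [j' []]] : 1 < #|[set~ k]| by rewrite cardsC1 card_ord; lia.
rewrite !inE; have [u <-] := vtx j; have [u' <-] := vtx j' => uk u'k uu'.
apply/card_gt1P; exists u, u'; rewrite !inE; split=> //.
by apply: contraNneq uu' => ->.
Qed.

End Multipartite.

Theorem theorem4p8 (m : nat) (n : 'I_m -> nat)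
    (hm : 2 <= m) (hn : forall i : 'I_m, 1 <= n i) :
  let G := complete_multipartite n in
  let N := \sum_(i < m) n i in
  let exceptional :=
    (forall i : 'I_m, n i = 1) \/ (m = 2 /\ exists i : 'I_m, n i = 1) in
  (exceptional -> deduction_number G = N - 1) /\
  (~ exceptional -> deduction_number G = N - 2).
Proof.
move=> G N exceptional; rewrite /N -card_complete_multipartite -/G.
have [L sL win] := deduction_number_attained G.
have [u [v uv]] : exists u v : G, adj u v.
  exists (Tagged (fun i => 'I_(n i)) (Ordinal (hn (Ordinal (ltnW hm))))).
  by exists (Tagged (fun i => 'I_(n i)) (Ordinal (hn (Ordinal hm)))).
have := deduction_number_adj uv; have := searchers_lower_bound win.
rewrite sL -/G => lower upper; split=> [exc|/(split_partP hm hn) split_ex].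
  case: lower => [|[_ /(split_partP hm hn)//]]; lia.
have [k /deduction_number_split] := split_ex; rewrite -/G.
by case: lower => [|[]]; lia.
Qed.
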